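(* Let $X$ be a locally compact Hausdorff space. Then the boundary $\mathcal{U}_{{\bf b}_F}X$ of the Freudenthal coarse proximity structure $(X,\mathcal{B}_C,{\bf b}_F)$ is homeomorphic to the Freudenthal boundary $FX\setminus X$.
   Context: Coarse proximity spaces. A bornology $\mathcal{B}$ on a set $X$ is a family of subsets containing all singletons and closed under subsets and finite unions; its members are called bounded. A coarse proximity on $(X,\mathcal{B})$ is a relation ${\bf b}$ on the power set of $X$ such that for all $A,B,C\subseteq X$: (1) $A{\bf b}B\Rightarrow B{\bf b}A$; (2) $A{\bf b}B\Rightarrow A,B\notin\mathcal{B}$; (3) $A\cap B\notin\mathcal{B}\Rightarrow A{\bf b}B$; (4) $(A\cup B){\bf b}C\iff A{\bf b}C$ or $B{\bf b}C$; (5) $A\bar{\bf b}B\Rightarrow\exists E\subseteq X$ with $A\bar{\bf b}E$ and $(X\setminus E)\bar{\bf b}B$ (a bar denotes negation). Then $(X,\mathcal{B},{\bf b})$ is a coarse proximity space. Proximities and clusters. A proximity on a set $X$ is a relation $\delta$ on the power set with: (1) $A\delta B\Rightarrow B\delta A$; (2) $A\delta B\Rightarrow A,B\ne\emptyset$; (3) $A\cap B\neq\emptyset\Rightarrow A\delta B$; (4) $A\delta(B\cup C)\iff A\delta B$ or $A\delta C$; (5) $A\bar\delta B\Rightarrow\exists E\subseteq X$ with $A\bar\delta E$ and $(X\setminus E)\bar\delta B$. It is separated if $\{x\}\delta\{y\}\iff x=y$. It induces the topology in which $A$ is closed iff ($A\delta\{x\}\Rightarrow x\in A$). A cluster in $(X,\delta)$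 is a collection $\sigma$ of subsets of $X$ such that: $A,B\in\sigma\Rightarrow A\delta B$; if $A\delta B$ for all $B\in\sigma$ then $A\in\sigma$; if $A\cup B\in\sigma$ then $A\in\sigma$ or $B\in\sigma$. For $\delta$ separated, the Smirnov compactification $\mathfrak{X}$ is the set of all clusters with the proximity $\mathcal{A}\delta^*\mathcal{C}$ iff $A\delta C$ for all $A,C\subseteq X$ such that $A\in\sigma$ for all $\sigma\in\mathcal{A}$ and $C\in\sigma$ for all $\sigma\in\mathcal{C}$; it is compact Hausdorff, and $X$ is identified with a dense subset of $\mathfrak{X}$ via $x\mapsto\sigma_x$, the unique cluster containing $\{x\}$. Freudenthal structures. Subsets $A,B$ of a topological space $X$ are separated by a compact set $K\subseteq X$ if there are disjoint open sets $U_1,U_2\subseteq X$ with $X\setminus K=U_1\cup U_2$, $A\subseteq U_1$, $B\subseteq U_2$. For $X$ locally compact Hausdorff, the Freudenthal proximity $\delta_F$ is the separated proximity given by: $A\bar\delta_FB$ iff $cl_X(A)$ and $cl_X(B)$ are separated by some compact set. The Freudenthal compactification $FX$ is the Smirnov compactification of $(X,\delta_F)$, and $FX\setminus X$ (subspace topology) is the set of clusters of $(X,\delta_F)$ containing no singleton. $\mathcal{B}_C$ is the bornology of subsets of $X$ with compact closure, and ${\bf b}_F$ is the coarse proximity given by: $A\bar{\bf b}_FB$ iff there are compact sets $D,K\subseteq X$ such that $A\setminus D$ and $B\setminus D$ are separated by $K$. Boundary. For a coarse proximity space $(X,\mathcal{B},{\bf b})$, the discrete extension is the separated proximity $A\delta_{dis}B\iff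 A\cap B\ne\emptyset$ or $A{\bf b}B$. The boundary $\mathcal{U}_{\bf b}X$ is the set of clusters in $(X,\delta_{dis})$ containing no bounded set, with the topology inherited from the Smirnov compactification of $(X,\delta_{dis})$. *)

(* Defs.v *)
From HB Require Import structures.
From mathcomp Require Import all_boot.
From mathcomp Require Import all_classical.
From mathcomp Require Import topology.

Set Implicit Arguments.
Unset Strict Implicit.
Unset Printing Implicit Defensive.

Local Open Scope classical_set_scope.

Definition homeomorphic (S T : topologicalType) : Prop :=
  exists (f : S -> T) (g : T -> S),
    [/\ cancel f g, cancel g f, continuous f & continuous g].

(** [bounded0] is the empty finite union; it only matters when [X] is empty. *)
Record bornology (X : Type) := Bornology {
  bounded :> set X -> Prop;
  bounded0 : bounded set0;
  bounded_set1 : forall x, bounded [set x];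
  boundedS : forall A B, A `<=` B -> bounded B -> bounded A;
  boundedU : forall A B, bounded A -> bounded B -> bounded (A `|` B)
}.

Record coarse_proximity (X : Type) (B : bornology X) := CoarseProximity {
  cprox :> set X -> set X -> Prop;
  cprox_sym : forall A C, cprox A C -> cprox C A;
  cprox_unbounded : forall A C, cprox A C -> ~ B A /\ ~ B C;
  cproxI : forall A C, ~ B (A `&` C) -> cprox A C;
  cproxUl : forall A C D, cprox (A `|` C) D <-> cprox A D \/ cprox C D;
  cprox_strong : forall A C, ~ cprox A C ->
    exists E, ~ cprox A E /\ ~ cprox (~` E) C
}.

Record proximity (X : Type) := Proximity {
  prox :> set X -> set X -> Prop;
  prox_sym : forall A B, prox A B -> prox B A;
  prox_neq0 : forall A B, prox A B -> A <> set0 /\ B <> set0;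
  proxI : forall A B, A `&` B <> set0 -> prox A B;
  proxUr : forall A B C, prox A (B `|` C) <-> prox A B \/ prox A C;
  prox_strong : forall A B, ~ prox A B ->
    exists E, ~ prox A E /\ ~ prox (~` E) B
}.

Definition prox_separated (X : Type) (d : proximity X) : Prop :=
  forall x y : X, d [set x] [set y] <-> x = y.

Section proximity_theory.
Context {X : Type} (d : proximity X).

Lemma proxSr A B C : B `<=` C -> d A B -> d A C.
Proof.
move=> BC AB; have -> : C = B `|` C by apply/esym/setUidPr.
by apply/proxUr; left.
Qed.

Lemma proxSl A B C : A `<=` B -> d A C -> d B C.
Proof. by move=> AB /prox_sym /(proxSr AB) /prox_sym. Qed.

Lemma proxUl A B C : d (A `|` B) C -> d A C \/ d B C.
Proof. by move=> /prox_sym/proxUr[] /prox_sym; [left|right]. Qed.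

Definition prox_closed (A : set X) : Prop := forall x, d A [set x] -> A x.

Definition prox_open (A : set X) : Prop := prox_closed (~` A).

Lemma prox_openT : prox_open setT.
Proof. by move=> x /prox_neq0[+ _]; rewrite setCT. Qed.

Lemma prox_openI : setI_closed prox_open.
Proof.
move=> A B oA oB x; rewrite setCI => /proxUl[/oA nA|/oB nB]; first by left.
by right.
Qed.

Lemma prox_open_bigU (I : Type) (f : I -> set X) :
  (forall i, prox_open (f i)) -> prox_open (\bigcup_i f i).
Proof.
move=> of_ x xU [i _ fix_]; apply: (of_ i x) fix_.
by apply: proxSl xU => y yU fiy; apply: yU; exists i.
Qed.

End proximity_theory.

(** [prox_space d] is an alias of [X] carrying the topology induced by [d]. *)
Definition prox_space (X : Type) (d : proximity X) : Type := X.

HB.instance Definition _ (X : Type) (d : proximity X) :=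
  gen_eqMixin (prox_space d).
HB.instance Definition _ (X : Type) (d : proximity X) :=
  gen_choiceMixin (prox_space d).
HB.instance Definition _ (X : Type) (d : proximity X) :=
  isOpenTopological.Build (prox_space d)
    (@prox_openT _ d) (@prox_openI _ d) (@prox_open_bigU _ d).

Record prox_cluster (X : Type) (d : proximity X) (s : set (set X)) : Prop :=
  ProxCluster {
    prox_cluster_near : forall A B, s A -> s B -> d A B;
    prox_cluster_max : forall A, (forall B, s B -> d A B) -> s A;
    prox_clusterU : forall A B, s (A `|` B) -> s A \/ s B
  }.

Record smirnov (X : Type) (d : proximity X) := Smirnov {
  smirnov_sets :> set X -> Prop;
  smirnovP : prox_cluster d smirnov_sets
}.

Section smirnov_theory.
Context {X : Type} (d : proximity X).
Implicit Types (s : smirnov d) (P Q R : set (smirnov d)) (A B C : set X).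

Lemma smirnovS s A B : A `<=` B -> s A -> s B.
Proof.
move=> AB sA; apply: (prox_cluster_max (smirnovP s)) => C sC.
exact: proxSl AB (prox_cluster_near (smirnovP s) sA sC).
Qed.

Lemma smirnovT s : s setT.
Proof.
apply: (prox_cluster_max (smirnovP s)) => C sC; apply: proxI.
by rewrite setTI => C0; have [] := prox_neq0 (prox_cluster_near (smirnovP s) sC sC).
Qed.

Lemma smirnovC s A : s A \/ s (~` A).
Proof. by apply: (prox_clusterU (smirnovP s)); rewrite setUv; exact: smirnovT. Qed.

Lemma smirnovI s A B : s A -> ~ s (~` B) -> s (A `&` B).
Proof.
move=> sA nsB; have : s ((A `&` B) `|` (A `&` ~` B)).
  by rewrite -setIUr setUv setIT.
case/(prox_clusterU (smirnovP s)) => // sAB; case: nsB.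
by apply: smirnovS sAB => x [].
Qed.

Lemma smirnov_far s A B : s A -> ~ d A B -> ~ s B.
Proof. by move=> sA nAB sB; apply/nAB/(prox_cluster_near (smirnovP s)). Qed.

Definition absorbs A P : Prop := forall s, P s -> s A.

Definition smirnov_near P Q : Prop :=
  forall A C, absorbs A P -> absorbs C Q -> d A C.

Lemma smirnov_farP P Q : ~ smirnov_near P Q ->
  exists A C, [/\ absorbs A P, absorbs C Q & ~ d A C].
Proof.
move=> nPQ; apply: contrapT => h; apply: nPQ => A C AP CQ.
by apply: contrapT => nAC; apply: h; exists A, C.
Qed.

Lemma smirnov_nearS P P' Q Q' : P `<=` P' -> Q `<=` Q' ->
  smirnov_near P Q -> smirnov_near P' Q'.
Proof.
move=> PP' QQ' PQ A C AP CQ.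
by apply: PQ => s sP; [apply/AP/PP'|apply/CQ/QQ'].
Qed.

Lemma smirnov_near_sym P Q : smirnov_near P Q -> smirnov_near Q P.
Proof. by move=> PQ A C AQ CP; apply/prox_sym/PQ. Qed.

Lemma smirnov_near_neq0 P Q : smirnov_near P Q -> P <> set0 /\ Q <> set0.
Proof.
move=> PQ; split => P0.
  have : d set0 setT.
    by apply: PQ => s; [rewrite P0|move=> _; exact: smirnovT].
  by move=> /prox_neq0[].
have : d setT set0.
  by apply: PQ => s; [move=> _; exact: smirnovT|rewrite P0].
by move=> /prox_neq0[].
Qed.

Lemma smirnov_nearI P Q : P `&` Q <> set0 -> smirnov_near P Q.
Proof.
move=> /eqP/set0P[s [Ps Qs]] A C AP CQ.
by apply: (prox_cluster_near (smirnovP s)); [exact: AP|exact: CQ].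
Qed.

Lemma smirnov_nearUr P Q R :
  smirnov_near P (Q `|` R) <-> smirnov_near P Q \/ smirnov_near P R.
Proof.
split=> [PQR|[]]; last 2 first.
- by apply: smirnov_nearS => // s; left.
- by apply: smirnov_nearS => // s; right.
apply: contrapT => /not_orP[/smirnov_farP[A [C [AP CQ nAC]]]].
move=> /smirnov_farP[B [D [BP DR nBD]]].
have [E [nAE nEC]] := prox_strong nAC.
have [F [nBF nFD]] := prox_strong nBD.
have EFP : absorbs (~` E `&` ~` F) P.
  move=> s Ps; have nsE := smirnov_far (AP _ Ps) nAE.
  have nsF := smirnov_far (BP _ Ps) nBF.
  apply: smirnovI; last by rewrite setCK.
  by case: (smirnovC s E).
have CDQR : absorbs (C `|` D) (Q `|` R).
  move=> s [Qs|Rs].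
    by apply: (smirnovS _ (CQ _ Qs)) => x; left.
  by apply: (smirnovS _ (DR _ Rs)) => x; right.
have /proxUr[] := PQR _ _ EFP CDQR.
  by move=> h; apply: nEC; apply: proxSl h => x [].
by move=> h; apply: nFD; apply: proxSl h => x [].
Qed.

Lemma smirnov_near_strong P Q : ~ smirnov_near P Q ->
  exists R, ~ smirnov_near P R /\ ~ smirnov_near (~` R) Q.
Proof.
move=> /smirnov_farP[A [C [AP CQ nAC]]].
have [E [nAE nEC]] := prox_strong nAC.
exists [set s : smirnov d | s E]; split.
  by move=> /(_ A E AP (fun s sE => sE)).
by move=> /(_ (~` E) C) h; apply/nEC/h => // s /=; case: (smirnovC s E).
Qed.

Definition smirnov_prox : proximity (smirnov d) :=
  Proximity smirnov_near_sym smirnov_near_neq0 smirnov_nearI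
    smirnov_nearUr smirnov_near_strong.

End smirnov_theory.

HB.instance Definition _ (X : Type) (d : proximity X) :=
  Topological.copy (smirnov d) (prox_space (smirnov_prox d)).

Lemma smirnov_closedP (X : Type) (d : proximity X) (P : set (smirnov d)) :
  closed P <-> forall s, smirnov_near P [set s] -> P s.
Proof. by rewrite -openC /open /= /prox_open setCK. Qed.

Section boundary.
Context {X : Type} {B : bornology X} (b : coarse_proximity B).

Definition disc_near (A C : set X) : Prop := A `&` C <> set0 \/ b A C.

Lemma cproxS A A' C C' : A `<=` A' -> C `<=` C' -> b A C -> b A' C'.
Proof.
move=> /setUidPr <- /setUidPr <- bAC.
apply/cproxUl; left; apply: cprox_sym; apply/cproxUl; left.
exact: cprox_sym.
Qed.

Lemma cprox_neq0l A C : b A C -> A <> set0.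
Proof. by move=> /cprox_unbounded[nA _] A0; apply: nA; rewrite A0; exact: bounded0. Qed.

Lemma disc_near_sym A C : disc_near A C -> disc_near C A.
Proof. by case=> [AC|/cprox_sym AC]; [left; rewrite setIC|right]. Qed.

Lemma disc_near_neq0 A C : disc_near A C -> A <> set0 /\ C <> set0.
Proof.
case=> [AC|bAC].
  by split=> e; apply: AC; rewrite e ?set0I ?setI0.
by split; [exact: cprox_neq0l bAC|exact: cprox_neq0l (cprox_sym bAC)].
Qed.

Lemma disc_nearI A C : A `&` C <> set0 -> disc_near A C.
Proof. by left. Qed.

Lemma disc_nearUr A C D :
  disc_near A (C `|` D) <-> disc_near A C \/ disc_near A D.
Proof.
rewrite /disc_near setIUr; split.
- case=> [/eqP/set0P[x [xAC|xAD]]|/cprox_sym/cproxUl[] /cprox_sym ?].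
  + by left; left; apply/eqP/set0P; exists x.
  + by right; left; apply/eqP/set0P; exists x.
  + by left; right.
  + by right; right.
- case=> -[h|h].
  + by left; rewrite setU_eq0 => -[].
  + by right; apply: cproxS h => // x; left.
  + by left; rewrite setU_eq0 => -[].
  + by right; apply: cproxS h => // x; right.
Qed.

Lemma disc_near_strong A C : ~ disc_near A C ->
  exists E, ~ disc_near A E /\ ~ disc_near (~` E) C.
Proof.
move=> /not_orP[/contrapT AC0 nAC]; have [E [nAE nEC]] := cprox_strong nAC.
exists ((E `&` ~` A) `|` C); split.
- case=> [|/cprox_sym/cproxUl[] /cprox_sym // bAE].
    by rewrite setIUr AC0 setU0 setICA setICr setI0.
  by apply: nAE; apply: cproxS bAE => // x [].
- rewrite setCU setCI setCK; case=> [|bEC].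
    by rewrite -setIA setICl setI0.
  have : b (~` E `|` A) C by apply: cproxS bEC => // x [].
  by case/cproxUl.
Qed.

Definition discrete_extension : proximity X :=
  Proximity disc_near_sym disc_near_neq0 disc_nearI disc_nearUr
    disc_near_strong.

Lemma discrete_extension_separated : prox_separated discrete_extension.
Proof.
move=> x y; split=> [[|/cprox_unbounded[]]|->].
- by move=> /eqP/set0P[z [/= <- <-]].
- by case; exact: bounded_set1.
by left; rewrite setIid; apply/eqP/set0P; exists y.
Qed.

(** The boundary of a coarse proximity space, as a subset of the Smirnov
    compactification of its discrete extension. *)
Definition boundary : set (smirnov discrete_extension) :=
  [set s | forall A, B A -> ~ s A].

End boundary.

Arguments boundary {X B} b _.

Section freudenthal.
Context {X : topologicalType}.
Implicit Types A B C K U : set X.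

Definition separated_by K A B : Prop :=
  exists U1 U2, [/\ open U1, open U2, U1 `&` U2 = set0,
    ~` K = U1 `|` U2 & A `<=` U1 /\ B `<=` U2].

Definition freudenthal_near A B : Prop :=
  ~ exists2 K, compact K & separated_by K (closure A) (closure B).

Definition freudenthal_coarse_near A B : Prop :=
  ~ exists D K, [/\ compact D, compact K & separated_by K (A `\` D) (B `\` D)].

Lemma separated_by_sym K A B : separated_by K A B -> separated_by K B A.
Proof.
move=> [U1 [U2 [o1 o2 d e [s1 s2]]]].
by exists U2, U1; split; rewrite 1?setIC 1?setUC.
Qed.

Lemma separated_byS K A A' B B' : A `<=` A' -> B `<=` B' ->
  separated_by K A' B' -> separated_by K A B.
Proof.
move=> AA' BB' [U1 [U2 [o1 o2 d e [s1 s2]]]].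
exists U1, U2; split=> //; split; first exact: subset_trans s1.
exact: subset_trans s2.
Qed.

Lemma separated_by_open K U1 U2 x : ~` K = U1 `|` U2 -> ~ K x ->
  ~ U1 x -> U2 x.
Proof.
by move=> e nKx nU1x; have : (~` K) x by []; rewrite e => -[].
Qed.

Hypothesis hX : hausdorff_space X.

Definition compact_bounded A : Prop := compact (closure A).

Lemma compact_bounded0 : compact_bounded set0.
Proof. by rewrite /compact_bounded closure0; exact: compact0. Qed.

Lemma compact_bounded1 x : compact_bounded [set x].
Proof.
rewrite /compact_bounded -(iffLR (closure_id _)); first exact: compact_set1.
exact: compact_closed hX (@compact_set1 _ x).
Qed.

Lemma compact_boundedS A B : A `<=` B -> compact_bounded B -> compact_bounded A.
Proof.
move=> AB cB; apply: (subclosed_compact _ cB); first exact: closed_closure.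
exact: closureS.
Qed.

Lemma compact_boundedU A B :
  compact_bounded A -> compact_bounded B -> compact_bounded (A `|` B).
Proof. by rewrite /compact_bounded closureU; exact: compactU. Qed.

Lemma compact_bounded_sub A K : A `<=` K -> compact K -> compact_bounded A.
Proof.
move=> AK cK; apply: compact_boundedS AK _.
by rewrite /compact_bounded -(iffLR (closure_id _))//; exact: compact_closed.
Qed.

Definition compact_bornology : bornology X :=
  Bornology compact_bounded0 compact_bounded1 compact_boundedS compact_boundedU.

Lemma freudenthal_coarse_sym A B :
  freudenthal_coarse_near A B -> freudenthal_coarse_near B A.
Proof.
apply: contra_not => -[D [K [cD cK s]]].
by exists D, K; split=> //; exact: separated_by_sym.
Qed.

Lemma freudenthal_coarse_unboundedl A B :
  freudenthal_coarse_near A B -> ~ compact_bornology A.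
Proof.
apply: contra_not => cA; exists (closure A), set0.
split=> //; first exact: compact0.
exists set0, setT; split; [exact: open0|exact: openT|by rewrite set0I| |].
  by rewrite setC0 set0U.
by split=> // x [] /subset_closure.
Qed.

Lemma freudenthal_coarse_unbounded A B : freudenthal_coarse_near A B ->
  ~ compact_bornology A /\ ~ compact_bornology B.
Proof.
move=> AB; split; first exact: freudenthal_coarse_unboundedl AB.
exact: freudenthal_coarse_unboundedl (freudenthal_coarse_sym AB).
Qed.

Lemma freudenthal_coarseI A B :
  ~ compact_bornology (A `&` B) -> freudenthal_coarse_near A B.
Proof.
apply: contra_not => -[D [K [cD cK [U1 [U2 [_ _ d _ [s1 s2]]]]]]].
apply: compact_bounded_sub cD => x [Ax Bx].
apply: contrapT => nDx; have : (U1 `&` U2) x by split; [exact: s1|exact: s2].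
by rewrite d.
Qed.

Lemma freudenthal_coarseUl A B C : freudenthal_coarse_near (A `|` B) C <->
  freudenthal_coarse_near A C \/ freudenthal_coarse_near B C.
Proof.
split; last first.
  case; apply: contra_not => -[D [K [cD cK s]]]; exists D, K; split=> //;
    by apply: (separated_byS _ _ s) => // x [Ax nDx]; split=> //; first [by left|by right].
apply: contraPP => /not_orP[/contrapT[D [K [cD cK]]]].
move=> [U1 [U2 [oU1 oU2 dU eK [AU1 CU2]]]].
move=> /contrapT[D' [L [cD' cL [W1 [W2 [oW1 oW2 dW eL [BW1 CW2]]]]]]] n.
apply: n; exists ((D `|` D') `|` (K `|` L)), (K `|` L).
split; [by apply: compactU; exact: compactU|exact: compactU|].
have cKL : open (~` (K `|` L)).
  by apply/closed_openC/(compact_closed hX)/compactU.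
exists ((U1 `|` W1) `&` ~` (K `|` L)), (U2 `&` W2); split.
- by apply: openI => //; exact: openU.
- exact: openI.
- rewrite -subset0 => x [[[U1x|W1x] _] [U2x W2x]].
    by rewrite -dU.
  by rewrite -dW.
- apply/seteqP; split=> [x nKLx|x [[_ //]|[U2x W2x]]].
    have [nK nL] : ~ K x /\ ~ L x by apply/not_orP.
    have : (~` K) x by []. rewrite eK => -[U1x|U2x]; first by left; split=> //; left.
    have : (~` L) x by []. rewrite eL => -[W1x|W2x]; first by left; split=> //; right.
    by right.
  move=> [Kx|Lx].
    by have : (~` K) x by rewrite eK; right.
  by have : (~` L) x by rewrite eL; right.
- split=> x [].
    move=> ABx /not_orP[/not_orP[nD nD'] nKL]; split=> //.
    by case: ABx => ?; [left; exact: AU1|right; exact: BW1].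
  move=> Cx /not_orP[/not_orP[nD nD'] _].
  by split; [exact: CU2|exact: CW2].
Qed.

Lemma freudenthal_coarse_strong A B : ~ freudenthal_coarse_near A B ->
  exists E, ~ freudenthal_coarse_near A E /\ ~ freudenthal_coarse_near (~` E) B.
Proof.
move=> /contrapT[D [K [cD cK [U1 [U2 [o1 o2 d e [s1 s2]]]]]]].
exists U2; split; apply.
  by exists D, K; split=> //; exists U1, U2; split=> //; split=> // x [].
exists (D `|` K), K; split=> //; first exact: compactU.
exists U1, U2; split=> //; split=> x [].
  move=> nU2 /not_orP[_ nK]; apply: (separated_by_open _ nK nU2).
  by rewrite setUC.
by move=> Bx /not_orP[nD _]; exact: s2.
Qed.

Definition freudenthal_coarse : coarse_proximity compact_bornology :=
  CoarseProximity freudenthal_coarse_sym freudenthal_coarse_unbounded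
    freudenthal_coarseI freudenthal_coarseUl freudenthal_coarse_strong.

Hypothesis lcX : locally_compact [set: X].

Lemma compact_nbhs_open K U : compact K -> open U -> K `<=` U ->
  exists V, [/\ open V, K `<=` V, compact (closure V) & closure V `<=` U].
Proof.
move=> cK oU KU; apply: contrapT => nV.
pose P A := exists V, [/\ open V, A `<=` V, compact (closure V)
  & closure V `<=` U].
pose F : set_system X := [set S | P (K `\` S)].
have PS A B : A `<=` B -> P B -> P A.
  move=> AB [V [oV BV cV VU]]; exists V; split=> //; exact: subset_trans BV.
have P0 : P set0.
  by exists set0; split; [exact: open0|by []| |];
    rewrite closure0 //; exact: compact0.
have FF : ProperFilter F.
  split; first by rewrite /F /= setD0.
  split; first by rewrite /F /= setDT.
    move=> S T [V [oV SV cV VU]] [W [oW TW cW WU]].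
    exists (V `|` W); split; first exact: openU.
    - by move=> x [Kx /not_andP[nS|nT]]; [left; apply: SV|right; apply: TW].
    - by rewrite closureU; exact: compactU.
    - by rewrite closureU subUset.
  by move=> S T ST; apply: PS => x [Kx nT]; split=> // /ST.
have FK : F K by rewrite /F /= setDv.
have [x [Kx clx]] := cK F FF FK.
have [C wC [cC clC]] := lcX (I : setT x).
have nC : nbhs x C.
  have := wC; rewrite /within /= => wC'.
  by apply: filterS wC' => y; apply.
have nU : nbhs x U by apply: open_nbhs_nbhs; split=> //; exact: KU.
have [N nN NCU] : filter_from (nbhs x) closure (C `&` U).
  by apply: (compact_regular hX cC nC); exact: filterI.
pose V := N°.
have clVN : closure V `<=` C `&` U.
  by apply: subset_trans NCU; apply: closureS; exact: interior_subset.
have PV : P V.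
  exists V; split=> //; first exact: open_interior.
    apply: (subclosed_compact _ cC); first exact: closed_closure.
    by move=> y /clVN[].
  by move=> y /clVN[].
have FnV : F (~` V) by apply: PS PV => y [_ /contrapT].
have [y [nVy Vy]] := clx _ _ FnV (nbhs_interior nN).
exact: nVy.
Qed.

Lemma separated_by_frontier A U C : closed A -> open U -> A `<=` U ->
  compact C -> closure U `<=` U `|` C -> A `&` C = set0 ->
  exists2 K, compact K & separated_by K A (~` U).
Proof.
move=> cA oU AU cC UC AC0.
have [|||V [oV CV cV VA]] := @compact_nbhs_open C (~` A) => //.
- exact: closed_openC.
- by move=> x Cx Ax; rewrite -[False]/(set0 x) -AC0.
exists ((closure V `\` V) `&` closure U).
  apply: subclosed_compact cV _; last by move=> x [[]].
  apply: closedI; last exact: closed_closure.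
  by apply: closedI; [exact: closed_closure|exact: open_closedC].
exists (U `&` ~` closure V), (V `|` ~` closure U); split.
- by apply: openI => //; apply: closed_openC; exact: closed_closure.
- by apply: openU => //; apply: closed_openC; exact: closed_closure.
- rewrite -subset0 => x [[Ux nVx] [Vx|nUx]].
    exact/nVx/subset_closure.
  exact/nUx/subset_closure.
- apply/seteqP; split=> x.
    move=> nx; have [Vx|nVx] := pselect (V x); first by right; left.
    have [clUx|] := pselect (closure U x); last by right; right.
    left; split; first by case: (UC _ clUx) => // /CV.
    by move=> clVx; apply: nx.
  case=> [[Ux nVx] [[]] //|[Vx [[]] //|nUx [_ //]]].
- split=> x; first by move=> Ax; split; [exact: AU|move=> /VA].
  move=> nUx; have [Ux|] := pselect (closure U x); last by right.
  by left; case: (UC _ Ux) => // /CV.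
Qed.

Lemma closure_separated K U1 U2 : compact K -> open U2 -> U1 `&` U2 = set0 ->
  ~` K = U1 `|` U2 -> closure U1 `<=` U1 `|` K.
Proof.
move=> cK oU2 d e x clx; have [|nK] := pselect (K x); first by right.
left; have : (~` K) x by []. rewrite e => -[//|U2x].
have [y] := clx U2 (open_nbhs_nbhs (conj oU2 U2x)).
by rewrite d.
Qed.

Lemma freudenthal_sym A B : freudenthal_near A B -> freudenthal_near B A.
Proof. by apply: contra_not => -[K cK /separated_by_sym s]; exists K. Qed.

Lemma freudenthal_neq0l A B : freudenthal_near A B -> A <> set0.
Proof.
apply: contra_not => ->; exists set0; first exact: compact0.
exists set0, setT; split; [exact: open0|exact: openT|by rewrite set0I| |].
  by rewrite setC0 set0U.
by rewrite closure0; split.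
Qed.

Lemma freudenthal_neq0 A B :
  freudenthal_near A B -> A <> set0 /\ B <> set0.
Proof.
move=> AB; split; first exact: freudenthal_neq0l AB.
exact: freudenthal_neq0l (freudenthal_sym AB).
Qed.

Lemma freudenthalI A B : A `&` B <> set0 -> freudenthal_near A B.
Proof.
move=> /eqP/set0P[x [Ax Bx]] [K _ [U1 [U2 [_ _ d _ [s1 s2]]]]].
have : (U1 `&` U2) x.
  by split; [apply: s1|apply: s2]; exact: subset_closure.
by rewrite d.
Qed.

Lemma freudenthalUr A B C : freudenthal_near A (B `|` C) <->
  freudenthal_near A B \/ freudenthal_near A C.
Proof.
split; last first.
  case; apply: contra_not => -[K cK s]; exists K => //;
    by apply: (separated_byS _ _ s) => //; apply: closureS => x; first [by left|by right].
apply: contraPP => /not_orP[/contrapT[K cK]].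
move=> [U1 [U2 [oU1 oU2 dU eK [AU1 BU2]]]].
move=> /contrapT[L cL [W1 [W2 [oW1 oW2 dW eL [AW1 CW2]]]]] n; apply: n.
have [|||||| M cM s] := @separated_by_frontier (closure A) (U1 `&` W1) (K `|` L).
- exact: closed_closure.
- exact: openI.
- by move=> x Ax; split; [exact: AU1|exact: AW1].
- exact: compactU.
- move=> x /closureI[/(closure_separated cK oU2 dU eK)[U1x|]]; last by right; left.
  by move=> /(closure_separated cL oW2 dW eL)[W1x|]; [left|right; right].
- rewrite -subset0 => x [Ax [Kx|Lx]].
    by have : (~` K) x by rewrite eK; left; exact: AU1.
  by have : (~` L) x by rewrite eL; left; exact: AW1.
exists M => //; apply: separated_byS s => //; rewrite closureU => x.
case=> [/BU2 U2x|/CW2 W2x] [U1x W1x].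
  by rewrite -[False]/(set0 x) -dU.
by rewrite -[False]/(set0 x) -dW.
Qed.

Lemma freudenthal_strong A B : ~ freudenthal_near A B ->
  exists E, ~ freudenthal_near A E /\ ~ freudenthal_near (~` E) B.
Proof.
move=> /contrapT[K cK [U1 [U2 [o1 o2 d e [s1 s2]]]]].
have d' : U2 `&` U1 = set0 by rewrite setIC.
have e' : ~` K = U2 `|` U1 by rewrite setUC.
have dK V : V `<=` U1 `|` U2 -> V `&` K = set0.
  by rewrite -e => VK; rewrite -subset0 => x [/VK].
exists (~` U1); split; apply.
  have [|||||| M cM s] := @separated_by_frontier (closure A) U1 K => //.
  - exact: closed_closure.
  - exact: closure_separated cK o2 d e.
  - by apply: dK => x /s1; left.
  exists M => //; apply: separated_byS s => //.
  by rewrite -(iffLR (closure_id _))//; exact: open_closedC.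
have [|||||| M cM s] := @separated_by_frontier (closure B) U2 K => //.
- exact: closed_closure.
- exact: closure_separated cK o1 d' e'.
- by apply: dK => x /s2; right.
exists M => //; apply: separated_by_sym; apply: separated_byS s => //.
rewrite setCK (iffLR (closure_id (~` U2))); last exact: open_closedC.
by apply: closureS; exact/disjoints_subset.
Qed.

Definition freudenthal_proximity : proximity X :=
  Proximity freudenthal_sym freudenthal_neq0 freudenthalI freudenthalUr
    freudenthal_strong.

Lemma freudenthal_proximity_separated : prox_separated freudenthal_proximity.
Proof.
have cl1 (x : X) : closed [set x] by exact: compact_closed hX (@compact_set1 _ x).
move=> x y; split=> [xy|->]; last first.
  by apply: freudenthalI; rewrite setIid; apply/eqP/set0P; exists y.
apply: contrapT => nxy; apply: xy.
have [||||||K cK s] := @separated_by_frontier [set x] (~` [set y]) [set y].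
- exact: cl1.
- exact: closed_openC.
- by move=> z -> /=.
- exact: compact_set1.
- by move=> z _; rewrite setUC setUv.
- by rewrite -subset0 => z [/= -> ].
exists K => //; move: s.
by rewrite setCK -!(iffLR (closure_id _)).
Qed.

Definition freudenthal_compactification : topologicalType :=
  smirnov freudenthal_proximity.

(** The embedded copy of [X] consists of the clusters containing a singleton. *)
Definition freudenthal_boundary : set freudenthal_compactification :=
  [set s : smirnov freudenthal_proximity | forall x, ~ s [set x]].

End freudenthal.

Arguments freudenthal_boundary {X} hX lcX _.

(* Main.v *)
Require Import Defs.
From mathcomp Require Import all_boot all_classical topology.

Set Implicit Arguments.
Unset Strict Implicit.
Unset Printing Implicit Defensive.

Local Open Scope classical_set_scope.

(** Both boundaries consist of the same families of subsets of [X], and the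
    homeomorphism sends a family to itself.

    The discrete extension of the Freudenthal coarse proximity and the
    Freudenthal proximity differ only in what happens on bounded sets: the
    discrete extension is the finer of the two, and two sets that are far for
    it become far for the Freudenthal proximity once a suitable bounded set is
    removed from both ([freudenthal_coarse_far]).  A cluster without bounded
    members does not notice the removal of a bounded set ([free_setD]), so for
    such families being a cluster means the same for both proximities
    ([free_cluster_coarser], [free_cluster_finer]).  In one direction this also
    uses that a bounded set is Freudenthal-far from the complement of some
    larger bounded set ([freudenthal_bounded_far]): that is local compactness.
    The same removal argument shows that the proximities of the two Smirnov
    compactifications coincide on sets of such clusters, hence that the
    subspace topologies agree ([free_clusters_homeomorphic]).

    The Freudenthal boundary is cut out by the weaker requirement that a
    cluster contain no singleton.  By a compactness argument the two
    requirements are equivalent ([freudenthal_cluster_compact]): the points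
    of the closure of a bounded member cannot all have neighbourhoods outside
    the cluster. *)

(** * Continuity for the topology of a Smirnov compactification *)

Section smirnov_topology.
Context {X : Type} {d : proximity X}.

Lemma smirnov_ext (s t : smirnov d) :
  smirnov_sets s = smirnov_sets t -> s = t.
Proof.
case: s t => [s sP] [t tP] /= st; case: t / st tP => tP.
by rewrite (Prop_irrelevance sP tP).
Qed.

(** This set is the closure of [P]; the strong axiom is what makes
    nearness to [P] stable under passing to limits. *)
Lemma closed_smirnov_near (P : set (smirnov d)) :
  closed [set s | smirnov_near P [set s]].
Proof.
apply/smirnov_closedP => s nPs; apply: contrapT => fPs.
have [R [fPR fRs]] := smirnov_near_strong fPs.
apply/fRs/(smirnov_nearS _ _ nPs) => // t Pt Rt.
by apply/fPR/(smirnov_nearS _ _ Pt) => // u ->.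
Qed.

End smirnov_topology.

(** Proximally continuous maps are continuous, for maps between subspaces of
    two Smirnov compactifications. *)
Lemma smirnov_continuous (X Y : Type) (d : proximity X) (e : proximity Y)
    (P : set (smirnov d)) (Q : set (smirnov e))
    (f : set_type P -> set_type Q) :
  (forall (R : set (set_type P)) s,
    smirnov_near (val @` R) [set val s] ->
    smirnov_near ((val \o f) @` R) [set val (f s)]) ->
  continuous f.
Proof.
move=> fnear; apply: (@continuous_comp_initial (set_type Q) (set_type P)
  (smirnov e) set_val f).
apply/continuous_closedP => S /smirnov_closedP cS.
set R := _ @^-1` S.
suff -> : R = val @^-1` [set s | smirnov_near (val @` R) [set s]].
  apply: preimage_closed; last exact: closed_smirnov_near.
  by move=> s _; exact: initial_continuous.
apply/seteqP; split=> s /=.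
  move=> Rs; apply: smirnov_nearI; apply/eqP/set0P.
  by exists (val s); split=> //; exists s.
move=> /fnear ns; apply: cS; apply: smirnov_nearS ns => // _ [t Rt <-].
exact: Rt.
Qed.

(** * Proximities that agree up to bounded sets *)

Section free_clusters.
Context {X : Type} (B : bornology X).
Implicit Types (d e : proximity X) (A C D : set X) (s : set (set X)).

Definition free s : Prop := forall A, B A -> ~ s A.

Definition free_clusters d : set (smirnov d) := [set s | free s].

(** The third field makes bounded sets invisible from infinity for the coarser
    proximity, so that removing them does not affect nearness to members of a
    free cluster. *)
Record coarser_up_to_bounded d e : Prop := CoarserUpToBounded {
  coarser_near : forall A C, d A C -> e A C;
  coarser_far : forall A C, ~ d A C ->
    exists2 D, B D & ~ e (A `\` D) (C `\` D);
  coarser_bounded : forall A, B A -> exists2 D, B D & ~ e A (~` D)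
}.

Lemma free_setD d s A D : prox_cluster d s -> free s -> B D ->
  s A -> s (A `\` D).
Proof.
move=> cs fs BD sA; have : s ((A `\` D) `|` (A `&` D)) by rewrite setUC setUIDK.
case/(prox_clusterU cs) => // sAD; case: (fs (A `&` D)) => //.
exact: boundedS BD.
Qed.

(** The only issue is maximality.  If [A] is far from the member [C] in the
    finer sense, split [A] along the bounded set [D] that witnesses it: removing
    from [C] both [D] and a bounded neighbourhood [D'] of [A `&` D] leaves a
    member of [s] that is far from both pieces of [A]. *)
Lemma free_cluster_coarser d e s : coarser_up_to_bounded d e -> free s ->
  prox_cluster d s -> prox_cluster e s.
Proof.
move=> de fs cs; split.
- by move=> A C sA sC; exact/(coarser_near de)/(prox_cluster_near cs).
- move=> A nA; apply: (prox_cluster_max cs) => C sC.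
  apply: contrapT => /(coarser_far de)[D BD fAC].
  have [|D' BD' fD'] := coarser_bounded de (A := A `&` D).
    exact: boundedS BD.
  have /nA : s (C `\` (D `|` D')).
    by apply: (free_setD cs fs) sC; exact: (boundedU BD BD').
  rewrite -{1}(setUIDK A D) => /proxUl[nD'|nD].
    by apply: fD'; apply: proxSr nD' => x [_] /not_orP[].
  by apply: fAC; apply: proxSr nD => x [Cx /not_orP[]].
- exact: prox_clusterU cs.
Qed.

Lemma free_cluster_finer d e s : coarser_up_to_bounded d e -> free s ->
  prox_cluster e s -> prox_cluster d s.
Proof.
move=> de fs cs; split.
- move=> A C sA sC; apply: contrapT => /(coarser_far de)[D BD]; apply.
  by apply: (prox_cluster_near cs); exact: (free_setD cs).
- move=> A nA; apply: (prox_cluster_max cs) => C sC.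
  exact/(coarser_near de)/nA.
- exact: prox_clusterU cs.
Qed.

Lemma free_smirnov_near d e (P Q : set (smirnov d))
    (P' Q' : set (smirnov e)) : coarser_up_to_bounded d e ->
  P' `<=` @free_clusters e -> Q' `<=` @free_clusters e ->
  (forall A, absorbs A P <-> absorbs A P') ->
  (forall A, absorbs A Q <-> absorbs A Q') ->
  smirnov_near P Q <-> smirnov_near P' Q'.
Proof.
move=> de fP fQ PP' QQ'; split=> nPQ A C; last first.
  move=> /PP' AP /QQ' CQ; apply: contrapT => /(coarser_far de)[D BD]; apply.
  apply: nPQ => s Ps; apply: (free_setD (smirnovP s)) => //.
  - exact: fP.
  - exact: AP.
  - exact: fQ.
  - exact: CQ.
by move=> /PP' AP /QQ' CQ; exact/(coarser_near de)/nPQ.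
Qed.

Theorem free_clusters_homeomorphic d e : coarser_up_to_bounded d e ->
  homeomorphic (set_type (@free_clusters d)) (set_type (@free_clusters e)).
Proof.
move=> de.
have cf (s : set_type (@free_clusters d)) :
    prox_cluster e (smirnov_sets (val s)).
  exact: (free_cluster_coarser de (set_valP s) (smirnovP _)).
have cg (s : set_type (@free_clusters e)) :
    prox_cluster d (smirnov_sets (val s)).
  exact: (free_cluster_finer de (set_valP s) (smirnovP _)).
pose f (s : set_type (@free_clusters d)) : set_type (@free_clusters e) :=
  exist _ (Smirnov (cf s)) (mem_set (set_valP s : free _)).
pose g (s : set_type (@free_clusters e)) : set_type (@free_clusters d) :=
  exist _ (Smirnov (cg s)) (mem_set (set_valP s : free _)).
exists f, g; split.
- by move=> s; apply/val_inj/smirnov_ext.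
- by move=> s; apply/val_inj/smirnov_ext.
- apply: smirnov_continuous => R s.
  apply: (iffLR (free_smirnov_near de _ _ _ _)).
  + by move=> _ [t _ <-]; exact: (set_valP (f t)).
  + by move=> _ ->; exact: (set_valP (f s)).
  + move=> A; split=> AR _ [t Rt <-]; first by apply: (AR (val t)); exists t.
    by apply: (AR (val (f t))); exists t.
  + move=> A; split=> As _ ->; first exact: (As (val s)).
    exact: (As (val (f s))).
- apply: smirnov_continuous => R s.
  apply: (iffRL (free_smirnov_near de _ _ _ _)).
  + by move=> _ [t _ <-]; exact: (set_valP t).
  + by move=> _ ->; exact: (set_valP s).
  + move=> A; split=> AR _ [t Rt <-]; last by apply: (AR (val t)); exists t.
    by apply: (AR (val (g t))); exists t.
  + move=> A; split=> As _ ->; last exact: (As (val s)).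
    exact: (As (val (g s))).
Qed.

End free_clusters.

(** * The Freudenthal proximity away from bounded sets *)

Section freudenthal_at_infinity.
Context {X : topologicalType} (hX : hausdorff_space X).
Context (lcX : locally_compact [set: X]).
Implicit Types A C D : set X.

(** The frontier of a relatively compact open neighbourhood of [closure A] is a
    compact set that separates. *)
Lemma freudenthal_bounded_far A : compact_bounded A ->
  exists2 D, compact_bounded D & ~ freudenthal_near A (~` D).
Proof.
move=> cA; have [|V [oV AV cV _]] := compact_nbhs_open hX lcX cA openT.
  by [].
exists V => //; apply.
have [||||||K cK s] :=
  @separated_by_frontier _ hX lcX (closure A) V (closure V `\` V) => //.
- exact: closed_closure.
- apply: subclosed_compact cV _; last by move=> x [].
  by apply: closedI; [exact: closed_closure|exact: open_closedC].
- by move=> x Vx; have [|] := pselect (V x); [left|right].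
- by rewrite -subset0 => x [/AV Vx [_]].
exists K => //; rewrite -(iffLR (closure_id (~` V))) //.
exact: open_closedC.
Qed.

Lemma freudenthal_near_coarse A C :
  freudenthal_coarse_near A C -> freudenthal_near A C.
Proof.
apply: contra_not => -[K cK s]; exists set0, K; split=> //.
  exact: compact0.
by rewrite !setD0; apply: separated_byS s; exact: subset_closure.
Qed.

(** If [A] and [C] minus [D] are separated by [K], their closures could still
    meet inside [K]; removing a neighbourhood [V] of [K] as well keeps the
    closures away from [K], so that [K] separates them too. *)
Lemma freudenthal_coarse_far A C : ~ freudenthal_coarse_near A C ->
  exists2 D, compact_bounded D & ~ freudenthal_near (A `\` D) (C `\` D).
Proof.
move=> /contrapT[D [K [cD cK [U1 [U2 [o1 o2 dU eK [AU CU]]]]]]].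
have [|V [oV KV cV _]] := compact_nbhs_open hX lcX cK openT; first by [].
exists (D `|` V).
  by apply: (compact_boundedU _ cV); exact: (compact_bounded_sub hX _ cD).
apply; exists K => //; exists U1, U2; split=> //.
have clS S U : S `\` D `<=` U -> closure U `<=` U `|` K ->
    closure (S `\` (D `|` V)) `<=` U.
  move=> SU UK x clx.
  have [|//|Kx] := UK x.
    apply: closureS clx => y [Sy /not_orP[nD _]]; exact: SU.
  have [y [[_ nV]] Vy] := clx V (open_nbhs_nbhs (conj oV (KV _ Kx))).
  by case: nV; right.
split; apply: clS => //; first exact: closure_separated dU eK.
by apply: (@closure_separated _ K U2 U1) => //; rewrite 1?setIC 1?setUC.
Qed.

(** Were a set with compact closure a member, the complements of the
    non-members would trace a proper filter on its closure; a cluster point [x]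
    of that filter has no neighbourhood outside the cluster, which forces
    [set x] into it. *)
Lemma freudenthal_cluster_compact (s : smirnov (freudenthal_proximity hX lcX))
    A : (forall x, ~ s [set x]) -> compact_bounded A -> ~ s A.
Proof.
move=> ns cA sA.
have ns0 : ~ s set0.
  by move=> s0; have [] := prox_neq0 (prox_cluster_near (smirnovP s) s0 s0).
pose F : set_system X := [set S | ~ s (closure A `\` S)].
have FF : ProperFilter F.
  split.
    by rewrite /F /= setD0; apply; exact: smirnovS (@subset_closure _ A) sA.
  split; first by rewrite /F /= setDT.
    move=> S T FS FT; rewrite /F /= setDIr.
    by move=> /(prox_clusterU (smirnovP s))[].
  move=> S T ST; apply: contra_not; apply: smirnovS => x [Ax nTx].
  by split=> // /ST.
have [|x [_ clx]] := cA F FF _; first by rewrite /F /= setDv.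
apply: (ns x); apply: (prox_cluster_max (smirnovP s)) => C sC.
apply: contrapT => fxC; have [E [fxE fEC]] := prox_strong fxC.
have nE : nbhs x (~` closure E).
  apply: open_nbhs_nbhs; split; first exact/closed_openC/closed_closure.
  move: fxE => /contrapT[K _ [U1 [U2 [_ _ dU _ [xU EU]]]]] /EU U2x.
  have : (U1 `&` U2) x by split=> //; apply: xU; exact: subset_closure.
  by rewrite dU.
have FE : F E.
  move=> sE; apply: fEC; apply: (prox_cluster_near (smirnovP s)) sC.
  by apply: smirnovS sE => y [].
by have [y [/subset_closure]] := clx _ _ FE nE.
Qed.

Lemma freudenthal_boundaryE : freudenthal_boundary hX lcX =
  @free_clusters _ (compact_bornology hX) (freudenthal_proximity hX lcX).
Proof.
apply/seteqP; split=> s /= fs.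
  by move=> A; exact: freudenthal_cluster_compact.
by move=> x; apply: fs; exact: compact_bounded1.
Qed.

Lemma freudenthal_coarser_discrete : coarser_up_to_bounded
  (compact_bornology hX) (discrete_extension (freudenthal_coarse hX))
  (freudenthal_proximity hX lcX).
Proof.
split; last exact: freudenthal_bounded_far.
- move=> A C [|]; first exact: freudenthalI.
  exact: freudenthal_near_coarse.
- by move=> A C /not_orP[_]; exact: freudenthal_coarse_far.
Qed.

End freudenthal_at_infinity.

Theorem theorem9p8 (X : topologicalType) (lcX : locally_compact [set: X])
    (hX : hausdorff_space X) :
  homeomorphic (set_type (boundary (freudenthal_coarse hX)))
               (set_type (freudenthal_boundary hX lcX)).
Proof.
rewrite freudenthal_boundaryE.
exact: free_clusters_homeomorphic (freudenthal_coarser_discrete hX lcX).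
Qed.
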